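(* Let $(M_n)_{n\in\mathbb{N}_0}$ be a log-convex sequence of positive real numbers. Then the following are equivalent: (i) the class $C\{M_n\}$ is quasi-analytic; (ii) for some $j\in\mathbb{N}$ the class $C\{\sqrt[j]{M_{jn}}\}$ is quasi-analytic; (iii) for every $j\in\mathbb{N}$ the class $C\{\sqrt[j]{M_{jn}}\}$ is quasi-analytic.
   Context: $\mathbb{N}=\{1,2,\ldots\}$ and $\mathbb{N}_0=\mathbb{N}\cup\{0\}$. A sequence $(M_n)_{n\in\mathbb{N}_0}$ of positive reals is log-convex if $M_n^2\le M_{n-1}M_{n+1}$ for all $n\ge1$. For a sequence $(M_n)_{n\in\mathbb{N}_0}$ of positive reals, $C\{M_n\}$ is the set of all real valued $f\in\mathcal{C}^\infty(\mathbb{R})$ for which there are constants $\beta_f,B_f>0$ (depending only on $f$) with $\sup_{x\in\mathbb{R}}|D^nf(x)|\le\beta_fB_f^nM_n$ for all $n\in\mathbb{N}_0$. The class $C\{M_n\}$ is quasi-analytic if $f\in C\{M_n\}$ and $(D^nf)(0)=0$ for all $n\in\mathbb{N}_0$ imply $f(x)=0$ for all $x\in\mathbb{R}$. $C\{\sqrt[j]{M_{jn}}\}$ is the class associated to the sequence $(\sqrt[j]{M_{jn}})_{n\in\mathbb{N}_0}$. *)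

(* Defs.v *)
From Stdlib Require Import Reals.
From Coquelicot Require Import Coquelicot.
Open Scope R_scope.

Definition positive_seq (M : nat -> R) : Prop :=
  forall n : nat, 0 < M n.

Definition log_convex (M : nat -> R) : Prop :=
  forall n : nat, (1 <= n)%nat -> M n ^ 2 <= M (n - 1)%nat * M (n + 1)%nat.

(* [Derive_n] is total, so its values are meaningful only under this
   hypothesis; existence of all derivatives gives their continuity. *)
Definition smooth (f : R -> R) : Prop :=
  forall (n : nat) (x : R), ex_derive_n f n x.

(* The class C{M_n}; the bound on the supremum over x is stated pointwise. *)
Definition carleman_class (M : nat -> R) (f : R -> R) : Prop :=
  smooth f /\
  exists beta B : R, 0 < beta /\ 0 < B /\
    forall (n : nat) (x : R), Rabs (Derive_n f n x) <= beta * B ^ n * M n.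

Definition quasi_analytic (M : nat -> R) : Prop :=
  forall f : R -> R,
    carleman_class M f ->
    (forall n : nat, Derive_n f n 0 = 0) ->
    forall x : R, f x = 0.

(* The j-th root of M_{jn}; [Rpower] is the real power of a positive base, so
   this has the intended meaning for positive M and j >= 1. *)
Definition root_seq (j : nat) (M : nat -> R) (n : nat) : R :=
  Rpower (M (j * n)%nat) (/ INR j).

(* Main.v *)
Require Import Defs.
From Stdlib Require Import Reals Lra Lia.
From Coquelicot Require Import Coquelicot.
Open Scope R_scope.

(** After rescaling, M_0 = M_1 = 1; then N_n = M_{jn}^{1/j} dominates M_n, so
    C{M_n} is contained in C{N_n} and quasi-analyticity passes from N to M.
    The converse avoids the Denjoy-Carleman theorem. From a nonzero flat
    f in C{N_n} one builds a nonnegative bump F, supported in some [0, A], with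
    |D^n F| <= b B^n N_{n-1}, and takes its j-fold convolution power G. Of the
    jn + r derivatives of G, each factor receives n or n + 1, so that
    |D^{jn+r} G| <= b' B^{jn+r} N_n^j with N_n^j = M_{jn} <= M_{jn+r}. Hence G
    is in C{M_n}, it vanishes on x <= 0, and it is nonzero because F >= 0. *)

(** * Towers of successive derivatives *)

(** Carrying all derivatives as one explicit family lets products, cuts, primitives and convolutions
    be built together with their derivatives; [Derive_n] enters only at both ends of the
    argument. *)
Definition derivative_tower (F : nat -> R -> R) : Prop :=
  forall (n : nat) (x : R), is_derive (F n) x (F (S n) x).

Lemma is_derive_continuous (f : R -> R) (x l : R) :
  is_derive f x l -> continuous f x.
Proof.
  intros H. apply (@ex_derive_continuous R_AbsRing R_NormedModule f x).
  now exists l.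
Qed.

Lemma tower_continuous (F : nat -> R -> R) (n : nat) (x : R) :
  derivative_tower F -> continuous (F n) x.
Proof.
  intros HF. apply is_derive_continuous with (F (S n) x), HF.
Qed.

Lemma tower_Derive_n (F : nat -> R -> R) (n : nat) (x : R) :
  derivative_tower F -> Derive_n (F 0%nat) n x = F n x.
Proof.
  intros HF. revert x. induction n as [|n IH]; intros x; [reflexivity|].
  simpl. rewrite (Derive_ext _ _ _ IH). apply is_derive_unique, HF.
Qed.

Lemma tower_smooth (F : nat -> R -> R) :
  derivative_tower F -> smooth (F 0%nat).
Proof.
  intros HF [|n] x; [exact I|]. simpl.
  apply ex_derive_ext with (F n).
  - intros t. symmetry. now apply tower_Derive_n.
  - exists (F (S n) x). apply HF.
Qed.

Lemma smooth_tower (f : R -> R) : smooth f -> derivative_tower (Derive_n f).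
Proof. intros Hf n x. apply Derive_correct, (Hf (S n) x). Qed.

Lemma reflect_tower (F : nat -> R -> R) (c : R) :
  derivative_tower F -> derivative_tower (fun n x => (-1) ^ n * F n (c - x)).
Proof.
  intros HF n x.
  replace ((-1) ^ S n * F (S n) (c - x))
    with ((-1) ^ n * (-1 * F (S n) (c - x))) by (simpl; ring).
  apply is_derive_scal.
  apply (is_derive_comp (F n) (fun y => c - y)); [apply HF|].
  auto_derive; [exact I|ring].
Qed.

Lemma reflect_abs (n : nat) (y : R) : Rabs ((-1) ^ n * y) = Rabs y.
Proof. rewrite Rabs_mult, pow_1_abs. ring. Qed.

(** * Products of towers *)

(* The expansion of [D^n (f g)] without binomial coefficients: each step
   differentiates one of the two factors, giving 2^n terms. *)
Fixpoint leibniz (n : nat) (F G : nat -> R -> R) (x : R) : R :=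
  match n with
  | 0%nat => F 0%nat x * G 0%nat x
  | S m => leibniz m (fun k => F (S k)) G x + leibniz m F (fun k => G (S k)) x
  end.

Lemma leibniz_tower (F G : nat -> R -> R) :
  derivative_tower F -> derivative_tower G ->
  derivative_tower (fun n => leibniz n F G).
Proof.
  intros HF HG n. revert F G HF HG.
  induction n as [|n IH]; intros F G HF HG x.
  - apply (is_derive_mult (F 0%nat) (G 0%nat) x _ _ (HF 0%nat x) (HG 0%nat x)).
    intros; apply Rmult_comm.
  - apply (is_derive_plus (leibniz n (fun k => F (S k)) G)
                          (leibniz n F (fun k => G (S k)))).
    + apply IH; [intros k; apply HF|exact HG].
    + apply IH; [exact HF|intros k; apply HG].
Qed.

Lemma leibniz_zero (F G : nat -> R -> R) (n : nat) (x : R) :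
  (forall k, F k x = 0) \/ (forall k, G k x = 0) -> leibniz n F G x = 0.
Proof.
  revert F G. induction n as [|n IH]; intros F G H; simpl.
  - destruct H as [H|H]; rewrite H; ring.
  - rewrite !IH; [ring| |]; destruct H as [H|H]; auto.
Qed.

(** Each of the 2^n terms pairs orders p + i and q + k with i + k = n, and supermultiplicativity of
    [W] merges the two weights. The offsets p and q exist for the induction, which shifts one tower
    at a time. *)
Lemma leibniz_bound (W : nat -> R) (b c B x : R) (n : nat) :
  0 <= b -> 0 <= c -> 0 <= B ->
  (forall p q, W p * W q <= W (p + q)%nat) ->
  forall (p q : nat) (F G : nat -> R -> R),
  (forall k, Rabs (F k x) <= b * B ^ (p + k) * W (p + k)%nat) ->
  (forall k, Rabs (G k x) <= c * B ^ (q + k) * W (q + k)%nat) ->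
  Rabs (leibniz n F G x)
    <= b * c * 2 ^ n * B ^ (p + q + n) * W (p + q + n)%nat.
Proof.
  intros Hb Hc HB HW.
  induction n as [|n IH]; intros p q F G HF HG; simpl leibniz.
  - specialize (HF 0%nat). specialize (HG 0%nat).
    rewrite !Nat.add_0_r in *. rewrite Rabs_mult, pow_O, Rmult_1_r.
    eapply Rle_trans; [apply Rmult_le_compat; [apply Rabs_pos..|exact HF|exact HG]|].
    rewrite pow_add.
    replace (b * B ^ p * W p * (c * B ^ q * W q))
      with (b * c * (B ^ p * B ^ q) * (W p * W q)) by ring.
    apply Rmult_le_compat_l; [|apply HW].
    repeat apply Rmult_le_pos; try apply pow_le; assumption.
  - eapply Rle_trans; [apply Rabs_triang|].
    assert (H1 := IH (S p) q (fun k => F (S k)) G).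
    assert (H2 := IH p (S q) F (fun k => G (S k))).
    replace (S p + q + n)%nat with (p + q + S n)%nat in H1 by lia.
    replace (p + S q + n)%nat with (p + q + S n)%nat in H2 by lia.
    replace (2 ^ S n) with (2 ^ n + 2 ^ n) by (simpl; ring).
    rewrite Rmult_plus_distr_l, !Rmult_plus_distr_r.
    apply Rplus_le_compat; [apply H1|apply H2]; auto;
      intros k; rewrite Nat.add_succ_l, <- Nat.add_succ_r; auto.
Qed.

(** * Cutting a flat function to the right half-line *)

Definition cut (F : nat -> R -> R) (n : nat) (x : R) : R :=
  if Rle_dec x 0 then 0 else F n x.

Lemma cut_nonpos (F : nat -> R -> R) (n : nat) (x : R) : x <= 0 -> cut F n x = 0.
Proof. intros Hx. unfold cut. destruct (Rle_dec x 0); [reflexivity|lra]. Qed.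

Lemma cut_pos (F : nat -> R -> R) (n : nat) (x : R) : 0 < x -> cut F n x = F n x.
Proof. intros Hx. unfold cut. destruct (Rle_dec x 0); [lra|reflexivity]. Qed.

Lemma cut_abs (F : nat -> R -> R) (n : nat) (x : R) :
  Rabs (cut F n x) <= Rabs (F n x).
Proof.
  unfold cut. destruct (Rle_dec x 0); [rewrite Rabs_R0; apply Rabs_pos|lra].
Qed.

(** Only the origin matters: there each difference quotient is either 0 or that of [F n], and the
    latter tends to [F (S n) 0], which is 0 by flatness. *)
Lemma cut_tower (F : nat -> R -> R) :
  derivative_tower F -> (forall n, F n 0 = 0) -> derivative_tower (cut F).
Proof.
  intros HF H0 n x.
  destruct (total_order_T x 0) as [[Hx|Hx]|Hx].
  - apply is_derive_ext_loc with (fun _ => 0).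
    + assert (He : 0 < - x) by lra.
      exists (mkposreal _ He). intros y Hy.
      apply Rabs_lt_between' in Hy. simpl in Hy.
      symmetry. apply cut_nonpos. lra.
    + rewrite cut_nonpos by lra. apply (is_derive_const 0 x).
  - subst x. rewrite cut_nonpos by lra.
    apply is_derive_Reals. intros eps Heps.
    assert (HD := HF n 0). rewrite H0 in HD.
    apply is_derive_Reals in HD.
    destruct (HD eps Heps) as [d Hd]. exists d. intros h Hh Hhd.
    specialize (Hd h Hh Hhd). rewrite H0 in Hd.
    rewrite (cut_nonpos F n 0) by lra. rewrite Rplus_0_l in *.
    destruct (Rle_dec h 0) as [Hn|Hp].
    + rewrite cut_nonpos by exact Hn.
      replace ((0 - 0) / h - 0) with 0 by (field; exact Hh).
      rewrite Rabs_R0. exact Heps.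
    + rewrite cut_pos by lra. exact Hd.
  - apply is_derive_ext_loc with (F n).
    + exists (mkposreal _ Hx). intros y Hy.
      apply Rabs_lt_between' in Hy. simpl in Hy.
      symmetry. apply cut_pos. lra.
    + rewrite cut_pos by lra. apply HF.
Qed.

(** * Integrals and primitives *)

Lemma ex_RInt_continuous_all (f : R -> R) (a b : R) :
  (forall x, continuous f x) -> ex_RInt f a b.
Proof. intros Hf. apply @ex_RInt_continuous. intros; apply Hf. Qed.

Lemma RInt_zero (f : R -> R) (a b : R) :
  (forall x, Rmin a b < x < Rmax a b -> f x = 0) -> RInt f a b = 0.
Proof.
  intros Hf. rewrite (RInt_ext (V := R_CompleteNormedModule) f (fun _ => 0) a b Hf).
  rewrite RInt_const. apply Rmult_0_r.
Qed.

Lemma RInt_pos_at (f : R -> R) (a b c : R) :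
  (forall x, continuous f x) -> (forall x, a < x < b -> 0 <= f x) ->
  a < c < b -> 0 < f c -> 0 < RInt f a b.
Proof.
  intros Hf Hpos Hc Hfc.
  (* With tolerance [f c] itself, continuity keeps f positive on a ball around c; [e] then fits an
     interval around c into that ball and into [a, b]. *)
  destruct (proj1 (filterlim_locally f (f c)) (Hf c) (mkposreal _ Hfc))
    as [d Hd].
  set (e := Rmin (d / 2) (Rmin (c - a) (b - c))).
  assert (Hd0 := cond_pos d).
  assert (He : 0 < e) by (repeat apply Rmin_pos; lra).
  assert (He1 : e <= d / 2) by apply Rmin_l.
  assert (He2 : e <= Rmin (c - a) (b - c)) by apply Rmin_r.
  assert (He3 := Rmin_l (c - a) (b - c)).
  assert (He4 := Rmin_r (c - a) (b - c)).
  rewrite <- (RInt_Chasles f a (c - e) b) by now apply ex_RInt_continuous_all.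
  rewrite <- (RInt_Chasles f (c - e) (c + e) b)
    by now apply ex_RInt_continuous_all.
  assert (0 <= RInt f a (c - e)).
  { apply RInt_ge_0; [lra|now apply ex_RInt_continuous_all|].
    intros x Hx. apply Hpos. lra. }
  assert (0 <= RInt f (c + e) b).
  { apply RInt_ge_0; [lra|now apply ex_RInt_continuous_all|].
    intros x Hx. apply Hpos. lra. }
  assert (0 < RInt f (c - e) (c + e)).
  { apply RInt_gt_0; [lra| |intros; apply Hf].
    intros x Hx.
    assert (Hb : ball c d x) by (apply Rabs_lt_between'; lra).
    specialize (Hd x Hb). apply Rabs_lt_between' in Hd. simpl in Hd. lra. }
  unfold plus; simpl. lra.
Qed.

Definition integrate (F : nat -> R -> R) (n : nat) (x : R) : R :=
  match n with 0%nat => RInt (F 0%nat) 0 x | S m => F m x end.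

Lemma integrate_tower (F : nat -> R -> R) :
  derivative_tower F -> derivative_tower (integrate F).
Proof.
  intros HF [|n] x; [|apply HF]. simpl.
  apply is_derive_RInt with 0; [|now apply tower_continuous].
  exists (mkposreal _ Rlt_0_1). intros y _.
  apply (RInt_correct (F 0%nat)), ex_RInt_continuous_all.
  intros; now apply tower_continuous.
Qed.

(** * Convolution over an interval *)

(** This is the usual convolution on the line once [f] vanishes outside [0, A], as the bump does. *)
Definition conv (A : R) (f g : R -> R) (x : R) : R :=
  RInt (fun t => f t * g (x - t)) 0 A.

Lemma conv_integrand_continuous (f g : R -> R) (x t : R) :
  (forall y, continuous f y) -> (forall y, continuous g y) ->
  continuous (fun t => f t * g (x - t)) t.
Proof.
  intros Hf Hg. apply (continuous_mult f (fun t => g (x - t))); [apply Hf|].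
  apply (continuous_comp (fun t => x - t) g); [|apply Hg].
  apply is_derive_continuous with (-1). auto_derive; [exact I|ring].
Qed.

(** Differentiation under the integral sign: the limits 0 and A are fixed, so no boundary terms
    appear and the derivative falls on [g]. *)
Lemma conv_is_derive (A : R) (f g dg : R -> R) (x : R) :
  (forall y, continuous f y) -> (forall y, is_derive g y (dg y)) ->
  (forall y, continuous dg y) ->
  is_derive (conv A f g) x (conv A f dg x).
Proof.
  intros Hf Hg Hdg.
  assert (Hcg : forall y, continuous g y).
  { intros y. apply is_derive_continuous with (dg y), Hg. }
  assert (HD : forall y t, is_derive (fun u => f t * g (u - t)) y (f t * dg (y - t))).
  { intros y t. apply is_derive_scal.
    rewrite <- (Rmult_1_l (dg (y - t))).
    apply (is_derive_comp g (fun u => u - t)); [apply Hg|].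
    auto_derive; [exact I|ring]. }
  replace (conv A f dg x)
    with (RInt (fun t => Derive (fun u => f t * g (u - t)) x) 0 A).
  2:{ apply RInt_ext. intros t _. apply is_derive_unique, HD. }
  apply (is_derive_RInt_param (fun u t => f t * g (u - t))).
  - apply filter_forall. intros y t _. eexists. apply HD.
  - intros t _.
    apply continuity_2d_pt_ext with (fun u v => f v * dg (u - v)).
    { intros u v. symmetry. apply is_derive_unique, HD. }
    apply continuity_2d_pt_mult.
    + apply (continuity_1d_2d_pt_comp f (fun _ v => v)).
      * apply continuity_pt_filterlim, Hf.
      * apply continuity_2d_pt_id2.
    + apply (continuity_1d_2d_pt_comp dg (fun u v => u - v)).
      * apply continuity_pt_filterlim, Hdg.
      * apply continuity_2d_pt_minus;
          [apply continuity_2d_pt_id1|apply continuity_2d_pt_id2].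
  - apply filter_forall. intros y. apply ex_RInt_continuous_all.
    intros t. now apply conv_integrand_continuous.
Qed.

Lemma conv_tower (A : R) (f : R -> R) (G : nat -> R -> R) :
  (forall y, continuous f y) -> derivative_tower G ->
  derivative_tower (fun n => conv A f (G n)).
Proof.
  intros Hf HG n x. apply conv_is_derive; [exact Hf|apply HG|].
  intros y. now apply tower_continuous.
Qed.

(** Integrate the derivative of t -> F_p(t) G_q(x - t) over [0, A]; the boundary terms vanish, and
    the sign from x - t cancels the one from integration by parts. *)
Lemma conv_by_parts (A : R) (F G : nat -> R -> R) (p q : nat) (x : R) :
  derivative_tower F -> derivative_tower G ->
  F p 0 = 0 -> F p A = 0 ->
  conv A (F p) (G (S q)) x = conv A (F (S p)) (G q) x.
Proof.
  intros HF HG H0 HA.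
  assert (Hc : forall a b t, continuous (fun t => F a t * G b (x - t)) t).
  { intros a b t. apply conv_integrand_continuous;
      intros; now apply tower_continuous. }
  assert (HI : is_RInt (fun t => F (S p) t * G q (x - t) - F p t * G (S q) (x - t))
                 0 A (minus (F p A * G q (x - A)) (F p 0 * G q (x - 0)))).
  { apply (is_RInt_derive (fun t => F p t * G q (x - t))).
    - intros t _.
      replace (F (S p) t * G q (x - t) - F p t * G (S q) (x - t))
        with (F (S p) t * G q (x - t) + F p t * (- 1 * G (S q) (x - t))) by ring.
      apply (is_derive_mult (F p) (fun t => G q (x - t))).
      + apply HF.
      + apply (is_derive_comp (G q) (fun t => x - t)); [apply HG|].
        auto_derive; [exact I|ring].
      + intros; apply Rmult_comm.
    - intros t _. apply @continuous_minus; apply Hc. }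
  apply (@is_RInt_unique R_CompleteNormedModule) in HI. rewrite H0, HA in HI.
  rewrite (RInt_minus (V := R_CompleteNormedModule)
    (fun t => F (S p) t * G q (x - t)) (fun t => F p t * G (S q) (x - t))) in HI
    by (apply ex_RInt_continuous_all; apply Hc).
  unfold conv, minus, plus, opp in *. simpl in HI. lra.
Qed.

(** Repeated integration by parts lets the derivatives of a convolution be shared between its
    factors in any proportion. *)
Lemma conv_transfer (A : R) (F G : nat -> R -> R) (p q : nat) (x : R) :
  derivative_tower F -> derivative_tower G ->
  (forall n, F n 0 = 0) -> (forall n, F n A = 0) ->
  conv A (F 0%nat) (G (p + q)%nat) x = conv A (F p) (G q) x.
Proof.
  intros HF HG H0 HA. revert q. induction p as [|p IH]; intros q; [reflexivity|].
  rewrite Nat.add_succ_comm, IH. now apply conv_by_parts.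
Qed.

Lemma conv_bound (A a b : R) (f g : R -> R) (x : R) :
  0 <= A -> (forall y, continuous f y) -> (forall y, continuous g y) ->
  (forall y, Rabs (f y) <= a) -> (forall y, Rabs (g y) <= b) ->
  Rabs (conv A f g x) <= A * (a * b).
Proof.
  intros HA Hf Hg Ha Hb.
  rewrite <- (Rminus_0_r A) at 2.
  apply abs_RInt_le_const; [exact HA| |].
  - apply ex_RInt_continuous_all. intros; now apply conv_integrand_continuous.
  - intros t _. rewrite Rabs_mult.
    apply Rmult_le_compat; auto using Rabs_pos.
Qed.

(** * Log-convex and normalized sequences *)

(** The ratios M_{n+1} / M_n are nondecreasing, here with denominators cleared. *)
Lemma log_convex_ratio (M : nat -> R) (n k : nat) :
  positive_seq M -> log_convex M ->
  M (S n) * M (n + k)%nat <= M n * M (S (n + k)).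
Proof.
  intros hpos hconv. induction k as [|k IH].
  - rewrite Nat.add_0_r. lra.
  - assert (H := hconv (S (n + k))).
    replace (S (n + k) - 1)%nat with (n + k)%nat in H by lia.
    replace (S (n + k) + 1)%nat with (S (S (n + k))) in H by lia.
    specialize (H ltac:(lia)). rewrite <- plus_n_Sm.
    assert (P0 := hpos n). assert (P1 := hpos (S n)).
    assert (P2 := hpos (n + k)%nat). assert (P3 := hpos (S (n + k))).
    (* After this scaling the goal is the product of the induction hypothesis and log-convexity at n
       + k + 1. *)
    apply Rmult_le_reg_l with (M (n + k)%nat * M (S (n + k))); [nra|].
    replace (M (n + k)%nat * M (S (n + k)) * (M (S n) * M (S (n + k))))
      with ((M (S n) * M (n + k)%nat) * M (S (n + k)) ^ 2) by ring.
    replace (M (n + k)%nat * M (S (n + k)) * (M n * M (S (S (n + k)))))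
      with ((M n * M (S (n + k))) * (M (n + k)%nat * M (S (S (n + k))))) by ring.
    apply Rmult_le_compat; [nra|nra|exact IH|exact H].
Qed.

(** Raising p by one multiplies the left side by M_{p+1} / M_p and the right side by the larger
    ratio M_{p+q+1} / M_{p+q}. *)
Lemma log_convex_supermult (M : nat -> R) (p q : nat) :
  positive_seq M -> log_convex M -> M p * M q <= M 0%nat * M (p + q)%nat.
Proof.
  intros hpos hconv. induction p as [|p IH]; [simpl; lra|].
  assert (H := log_convex_ratio M p q hpos hconv).
  apply Rmult_le_reg_l with (M p); [apply hpos|].
  assert (P0 := hpos 0%nat). assert (P1 := hpos (S p)).
  assert (P2 := hpos p). assert (P3 := hpos q).
  apply Rle_trans with (M (S p) * (M 0%nat * M (p + q)%nat)); [nra|].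
  simpl. nra.
Qed.

(** M_0 = 1 removes the constant from supermultiplicativity; the first ratio being 1 makes all
    ratios at least 1, hence a log-convex M nondecreasing. *)
Definition normalized (M : nat -> R) : Prop := M 0%nat = 1 /\ M 1%nat = 1.

Lemma normalized_supermult (M : nat -> R) (p q : nat) :
  positive_seq M -> log_convex M -> normalized M ->
  M p * M q <= M (p + q)%nat.
Proof.
  intros hpos hconv [h0 _].
  assert (H := log_convex_supermult M p q hpos hconv). rewrite h0 in H. lra.
Qed.

Lemma normalized_le (M : nat -> R) (m n : nat) :
  positive_seq M -> log_convex M -> normalized M ->
  (m <= n)%nat -> M m <= M n.
Proof.
  intros hpos hconv [h0 h1] Hmn. induction Hmn as [|n Hmn IH]; [lra|].
  assert (H := log_convex_ratio M 0 n hpos hconv).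
  simpl in H. rewrite h0, h1 in H. lra.
Qed.

Lemma normalized_pow_le (M : nat -> R) (j n : nat) :
  positive_seq M -> log_convex M -> normalized M -> M n ^ j <= M (j * n)%nat.
Proof.
  intros hpos hconv hnorm. induction j as [|j IH].
  - simpl. rewrite (proj1 hnorm). lra.
  - simpl. apply Rle_trans with (M n * M (j * n)%nat).
    + apply Rmult_le_compat_l; [left; apply hpos|exact IH].
    + now apply normalized_supermult.
Qed.

(** * Root sequences and comparison of classes *)

Lemma root_seq_pos (M : nat -> R) (j n : nat) : 0 < root_seq j M n.
Proof. apply exp_pos. Qed.

Lemma inv_INR_nonneg (j : nat) : (1 <= j)%nat -> 0 <= / INR j.
Proof.
  intros Hj. left. apply Rinv_0_lt_compat, lt_0_INR. lia.
Qed.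

Lemma Rpower_root_pow (x : R) (j : nat) :
  (1 <= j)%nat -> 0 < x -> Rpower (x ^ j) (/ INR j) = x.
Proof.
  intros Hj Hx. rewrite <- Rpower_pow by exact Hx.
  rewrite Rpower_mult, Rinv_r by (apply not_0_INR; lia).
  now apply Rpower_1.
Qed.

Lemma root_seq_pow (M : nat -> R) (j n : nat) :
  (1 <= j)%nat -> positive_seq M -> root_seq j M n ^ j = M (j * n)%nat.
Proof.
  intros Hj hpos. unfold root_seq.
  rewrite <- Rpower_pow by apply exp_pos.
  rewrite Rpower_mult, Rinv_l by (apply not_0_INR; lia).
  apply Rpower_1, hpos.
Qed.

Lemma le_root_seq (M : nat -> R) (j n : nat) :
  (1 <= j)%nat -> positive_seq M -> log_convex M -> normalized M ->
  M n <= root_seq j M n.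
Proof.
  intros Hj hpos hconv hnorm.
  rewrite <- (Rpower_root_pow (M n) j Hj (hpos n)) at 1.
  apply Rle_Rpower_l; [now apply inv_INR_nonneg|].
  split; [apply pow_lt, hpos|now apply normalized_pow_le].
Qed.

Lemma root_seq_le (M : nat -> R) (j m n : nat) :
  (1 <= j)%nat -> positive_seq M -> log_convex M -> normalized M ->
  (m <= n)%nat -> root_seq j M m <= root_seq j M n.
Proof.
  intros Hj hpos hconv hnorm Hmn.
  apply Rle_Rpower_l; [now apply inv_INR_nonneg|].
  split; [apply hpos|]. apply normalized_le; auto. nia.
Qed.

Lemma root_seq_supermult (M : nat -> R) (j p q : nat) :
  (1 <= j)%nat -> positive_seq M -> log_convex M -> normalized M ->
  root_seq j M p * root_seq j M q <= root_seq j M (p + q).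
Proof.
  intros Hj hpos hconv hnorm. unfold root_seq.
  rewrite Rpower_mult_distr by apply hpos.
  apply Rle_Rpower_l; [now apply inv_INR_nonneg|].
  split; [apply Rmult_lt_0_compat; apply hpos|].
  rewrite Nat.mul_add_distr_l. now apply normalized_supermult.
Qed.

(** A geometric factor c d^n is absorbed by the constants beta and B, so C{M_n} lies in C{N_n}. *)
Lemma quasi_analytic_mono (M N : nat -> R) (c d : R) :
  0 < c -> 0 < d -> (forall n, M n <= c * d ^ n * N n) ->
  quasi_analytic N -> quasi_analytic M.
Proof.
  intros Hc Hd HMN HN f [Hs [b [B [Hb [HB Hf]]]]]. apply HN.
  split; [exact Hs|]. exists (b * c), (B * d).
  repeat split; try now apply Rmult_lt_0_compat.
  intros n x. eapply Rle_trans; [apply Hf|].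
  rewrite Rpow_mult_distr.
  replace (b * c * (B ^ n * d ^ n) * N n)
    with (b * B ^ n * (c * d ^ n * N n)) by ring.
  apply Rmult_le_compat_l; [|apply HMN].
  apply Rmult_le_pos; [lra|apply pow_le; lra].
Qed.

(** * Convolution powers of a bump *)

(* One-sidedness in [x <= 0] gives flatness at 0; the bound is the one enjoyed
   by a k-fold convolution when kn + r derivatives are spread over the k factors,
   n + 1 on r of them and n on the others. *)
Definition spread (k : nat) (B : R) (N : nat -> R) (G : nat -> R -> R) : Prop :=
  derivative_tower G /\
  (forall n x, x <= 0 -> G n x = 0) /\
  (forall x, 0 <= G 0%nat x) /\
  (exists x, 0 < G 0%nat x) /\
  exists b : R, 0 < b /\
    forall n r x, (r <= k)%nat ->
      Rabs (G (k * n + r)%nat x) <= b * B ^ (k * n + r) * N n ^ k.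

(** Of the derivatives, the bump receives n or n + 1 and [G] the rest; the weights N_n and N_n^k
    multiply to N_n^(k+1), and the interval contributes its length A. *)
Lemma spread_conv (k : nat) (A B : R) (N : nat -> R) (F G : nat -> R -> R) :
  0 < B -> (forall n, 0 < N n) ->
  spread 1 B N F -> (forall n x, A <= x -> F n x = 0) ->
  spread k B N G -> spread (S k) B N (fun n => conv A (F 0%nat) (G n)).
Proof.
  intros HB HN [HF [F0 [Fpos [[u Hu] [b [Hb Fb]]]]]] FA
    [HG [G0 [Gpos [[v Hv] [c [Hc Gb]]]]]].
  assert (Fc : forall n y, continuous (F n) y)
    by (intros; now apply tower_continuous).
  assert (Gc : forall n y, continuous (G n) y)
    by (intros; now apply tower_continuous).
  assert (Hu0 : 0 < u).
  { destruct (Rle_lt_dec u 0) as [H|H]; [|exact H].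
    rewrite (F0 0%nat u H) in Hu. lra. }
  assert (HuA : u < A).
  { destruct (Rle_lt_dec A u) as [H|H]; [|exact H].
    rewrite (FA 0%nat u H) in Hu. lra. }
  split; [|split; [|split; [|split]]].
  - now apply conv_tower.
  - intros n x Hx. apply RInt_zero.
    intros t Ht. rewrite Rmin_left in Ht by lra.
    rewrite (G0 n (x - t)) by lra. ring.
  - intros x. apply RInt_ge_0; [lra| |].
    + apply ex_RInt_continuous_all. intros; now apply conv_integrand_continuous.
    + intros t _. now apply Rmult_le_pos.
  (* At t = u, inside (0, A), the integrand at u + v is F(u) G(v) > 0. *)
  - exists (u + v). apply RInt_pos_at with u.
    + intros; now apply conv_integrand_continuous.
    + intros t _. now apply Rmult_le_pos.
    + lra.
    + replace (u + v - u) with v by ring. now apply Rmult_lt_0_compat.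
  - exists (A * b * c). split; [repeat apply Rmult_lt_0_compat; lra|].
    assert (Hstep : forall p q n, (p <= 1)%nat -> (q <= k)%nat -> forall x,
      Rabs (conv A (F 0%nat) (G (S k * n + (p + q))%nat) x)
        <= A * b * c * B ^ (S k * n + (p + q)) * N n ^ S k).
    { intros p q n Hp Hq x.
      replace (S k * n + (p + q))%nat
        with ((1 * n + p) + (k * n + q))%nat by lia.
      rewrite conv_transfer; auto with real.
      eapply Rle_trans.
      - apply conv_bound; [lra|apply Fc|apply Gc| |].
        + intros y. now apply Fb.
        + intros y. now apply Gb.
      - right. rewrite (pow_add B (1 * n + p)). simpl. ring. }
    (* If r > 0, one extra derivative goes to the bump, leaving at most k for [G]. *)
    intros n r x Hr. destruct r as [|r].
    + apply (Hstep 0%nat 0%nat); lia.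
    + apply (Hstep 1%nat r); lia.
Qed.

Lemma spread_exists (A B : R) (N : nat -> R) (F : nat -> R -> R) (k : nat) :
  0 < B -> (forall n, 0 < N n) ->
  spread 1 B N F -> (forall n x, A <= x -> F n x = 0) ->
  exists G, spread (S k) B N G.
Proof.
  intros HB HN HF FA. induction k as [|k [G HG]]; [now exists F|].
  eexists. eapply spread_conv; eassumption.
Qed.

(** * Construction of the bump *)

(** Reflection about 0 preserves flatness and the bounds, so a nonzero value at a negative point can
    be moved to the right; flatness excludes the origin. *)
Lemma flat_right (N : nat -> R) (f : R -> R) (x : R) :
  carleman_class N f -> (forall n, Derive_n f n 0 = 0) -> f x <> 0 ->
  exists (F : nat -> R -> R) (b B y : R),
    derivative_tower F /\ (forall n, F n 0 = 0) /\ 0 < b /\ 0 < B /\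
    (forall n t, Rabs (F n t) <= b * B ^ n * N n) /\ 0 < y /\ F 0%nat y <> 0.
Proof.
  intros [Hs [b [B [Hb [HB Hf]]]]] H0 Hx.
  assert (HF := smooth_tower f Hs).
  destruct (total_order_T x 0) as [[Hx0|Hx0]|Hx0].
  - exists (fun n t => (-1) ^ n * Derive_n f n (0 - t)), b, B, (- x).
    split; [|repeat split; try lra].
    + now apply reflect_tower.
    + intros n. rewrite Rminus_0_r, H0. ring.
    + intros n t. rewrite reflect_abs. apply Hf.
    + simpl. replace (0 - - x) with x by ring. lra.
  - exfalso. apply Hx. subst x. apply (H0 0%nat).
  - exists (Derive_n f), b, B, x. auto 10.
Qed.

(* With [h] the square of [f] (or of its reflection) cut to the right half-line
   and [H] its primitive, the bump is [H x * H (A - x)]. The primitive gains the index shift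
   N_{n-1} for N_n that the definition of [spread] needs. *)
Lemma bump_exists (N : nat -> R) (f : R -> R) (x : R) :
  (forall n, 0 < N n) -> (forall m n, (m <= n)%nat -> N m <= N n) ->
  (forall p q, N p * N q <= N (p + q)%nat) ->
  carleman_class N f -> (forall n, Derive_n f n 0 = 0) -> f x <> 0 ->
  exists (A B : R) (F : nat -> R -> R),
    0 < B /\ spread 1 B N F /\ (forall n t, A <= t -> F n t = 0).
Proof.
  intros HN Hle Hmul Hf H0 Hx.
  destruct (flat_right N f x Hf H0 Hx)
    as [F [b [B [y [HF [F0 [Hb [HB [Fb [Hy Fy]]]]]]]]]].
  set (h := fun n => leibniz n (cut F) (cut F)).
  assert (Hh : derivative_tower h)
    by (apply leibniz_tower; now apply cut_tower).
  assert (hc : forall t, continuous (h 0%nat) t)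
    by (intros; now apply tower_continuous).
  assert (h0 : forall n t, t <= 0 -> h n t = 0).
  { intros n t Ht. apply leibniz_zero. left. intros k. now apply cut_nonpos. }
  assert (hpos : forall t, 0 <= h 0%nat t) by (intros t; apply Rle_0_sqr).
  assert (hb : forall n t, Rabs (h n t) <= b * b * (2 * B) ^ n * N n).
  { intros n t. rewrite Rpow_mult_distr, <- Rmult_assoc.
    apply (leibniz_bound N b b B t n) with (p := 0%nat) (q := 0%nat);
      try lra; try assumption;
      intros k; eapply Rle_trans; [apply cut_abs|apply Fb|apply cut_abs|apply Fb]. }
  (* The midpoint of [0, A] is y + 1, where the bump equals the square of the primitive; that is
     positive because the integration passes y. *)
  set (A := 2 * (y + 1)).
  set (H := integrate h).
  assert (HH : derivative_tower H) by now apply integrate_tower.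
  assert (HHpos : forall t, 0 <= t -> 0 <= H 0%nat t).
  { intros t Ht. apply RInt_ge_0; [exact Ht|now apply ex_RInt_continuous_all|].
    intros; apply hpos. }
  assert (H00 : forall n t, t <= 0 -> H n t = 0).
  { intros [|n] t Ht; [|now apply h0]. apply RInt_zero.
    intros s Hs. rewrite Rmax_left in Hs by lra. apply h0. lra. }
  (* Order n + 1 of the primitive is order n of [h], hence the shifted weight; at order 0,
     [Nat.pred] gives N_0. *)
  set (W := fun n => N (Nat.pred n)).
  (* The summand A bounds the primitive itself by the interval length; 1 / (2B) pays for the shift
     from (2B)^n to (2B)^(n+1). *)
  set (c := b * b * (A + / (2 * B))).
  assert (HA : 0 < A) by (unfold A; lra).
  assert (HiB : 0 < / (2 * B)) by (apply Rinv_0_lt_compat; lra).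
  assert (Hbb : 0 < b * b) by now apply Rmult_lt_0_compat.
  assert (Hc : 0 < c) by (apply Rmult_lt_0_compat; lra).
  assert (HW : forall p q, W p * W q <= W (p + q)%nat).
  { intros p q. eapply Rle_trans; [apply Hmul|]. apply Hle. lia. }
  (* The primitive may keep growing to the right, so it is bounded only up to A; beyond A the other
     factor [K] of the bump vanishes. *)
  assert (Hbd : forall n t, t <= A -> Rabs (H n t) <= c * (2 * B) ^ n * W n).
  { intros n t Ht. destruct (Rle_lt_dec t 0) as [Ht0|Ht0].
    { rewrite H00, Rabs_R0 by exact Ht0.
      repeat apply Rmult_le_pos; try lra; [apply pow_le; lra|left; apply HN]. }
    destruct n as [|n].
    - apply Rle_trans with ((t - 0) * (b * b * (2 * B) ^ 0 * N 0%nat)).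
      + apply abs_RInt_le_const; [lra|now apply ex_RInt_continuous_all|].
        intros s _. apply hb.
      + unfold c, W. simpl. rewrite !Rmult_1_r, Rminus_0_r.
        rewrite <- Rmult_assoc. apply Rmult_le_compat_r; [left; apply HN|].
        rewrite (Rmult_comm t). apply Rmult_le_compat_l; lra.
    - apply Rle_trans with (b * b * (2 * B) ^ n * N n); [apply hb|].
      unfold c, W. simpl Nat.pred. apply Rmult_le_compat_r; [left; apply HN|].
      replace (b * b * (2 * B) ^ n)
        with (b * b * (/ (2 * B)) * (2 * B) ^ S n) by (simpl; field; lra).
      apply Rmult_le_compat_r; [apply pow_le; lra|].
      apply Rmult_le_compat_l; lra. }
  set (K := fun n t => (-1) ^ n * H n (A - t)).
  assert (HK : derivative_tower K) by now apply reflect_tower.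
  assert (K0 : forall n t, A <= t -> K n t = 0).
  { intros n t Ht. unfold K. rewrite H00 by lra. ring. }
  assert (Hb2 : forall n t,
    Rabs (leibniz n H K t) <= c * c * (4 * B) ^ n * W n).
  { intros n t.
    assert (Hnn : 0 <= c * c * (4 * B) ^ n * W n).
    { repeat apply Rmult_le_pos; try lra; [apply pow_le; lra|left; apply HN]. }
    destruct (Rle_lt_dec t 0) as [Ht|Ht].
    { rewrite leibniz_zero, Rabs_R0 by (left; intros k; now apply H00).
      exact Hnn. }
    destruct (Rle_lt_dec A t) as [HAt|HAt].
    { rewrite leibniz_zero, Rabs_R0 by (right; intros k; now apply K0).
      exact Hnn. }
    replace (4 * B) with (2 * (2 * B)) by ring.
    rewrite Rpow_mult_distr, <- Rmult_assoc.
    apply (leibniz_bound W c c (2 * B) t n) with (p := 0%nat) (q := 0%nat);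
      try lra; try assumption; intros k.
    - apply Hbd. lra.
    - unfold K. rewrite reflect_abs. apply Hbd. lra. }
  exists A, (4 * B), (fun n => leibniz n H K).
  split; [lra|]. split; [split; [|split; [|split; [|split]]]|].
  - now apply leibniz_tower.
  - intros n t Ht. apply leibniz_zero. left. intros k. now apply H00.
  - intros t. change (0 <= H 0%nat t * K 0%nat t).
    destruct (Rle_lt_dec t 0) as [Ht|Ht]; [rewrite H00 by exact Ht; lra|].
    destruct (Rle_lt_dec A t) as [HAt|HAt]; [rewrite K0 by exact HAt; lra|].
    unfold K. rewrite pow_O, Rmult_1_l. apply Rmult_le_pos; apply HHpos; lra.
  - exists (y + 1). change (0 < H 0%nat (y + 1) * K 0%nat (y + 1)). unfold K. rewrite pow_O, Rmult_1_l.
    replace (A - (y + 1)) with (y + 1) by (unfold A; ring).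
    assert (0 < H 0%nat (y + 1)).
    { apply RInt_pos_at with y; [exact hc|intros; apply hpos|lra|].
      unfold h. simpl. rewrite cut_pos by exact Hy. now apply Rsqr_pos_lt. }
    now apply Rmult_lt_0_compat.
  - exists (c * c). split; [now apply Rmult_lt_0_compat|].
    (* Since r <= 1, the predecessor of n + r is at most n: the derivative of order n + 1 still
       costs only N_n. *)
    intros n r t Hr. rewrite pow_1, Nat.mul_1_l.
    eapply Rle_trans; [apply Hb2|]. apply Rmult_le_compat_l.
    + apply Rmult_le_pos; [|apply pow_le; lra]. left. now apply Rmult_lt_0_compat.
    + apply Hle. lia.
  - intros n t Ht. apply leibniz_zero. right. intros k. now apply K0.
Qed.

(** * From a sequence to its roots *)

(** By contradiction: a nonzero flat function in the root class yields a bump, whose j-fold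
    convolution power is a nonzero flat function in C{M_n}. *)
Lemma quasi_analytic_root_normalized (M : nat -> R) (j : nat) :
  positive_seq M -> log_convex M -> normalized M -> (1 <= j)%nat ->
  quasi_analytic M -> quasi_analytic (root_seq j M).
Proof.
  intros hpos hconv hnorm Hj HM f Hf H0 x.
  destruct (Req_dec (f x) 0) as [Hx|Hx]; [exact Hx|exfalso].
  destruct (bump_exists (root_seq j M) f x) as [A [B [F [HB [HF FA]]]]]; auto.
  { intros; apply root_seq_pos. }
  { intros; now apply root_seq_le. }
  { intros; now apply root_seq_supermult. }
  destruct (spread_exists A B (root_seq j M) F (j - 1)) as [G HG]; auto.
  { intros; apply root_seq_pos. }
  replace (S (j - 1)) with j in HG by lia.
  destruct HG as [HG [G0 [_ [[u Hu] [b [Hb Gb]]]]]].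
  rewrite (HM (G 0%nat)) in Hu; [lra| |].
  - split; [now apply tower_smooth|]. exists b, B. repeat split; auto.
    intros m t. rewrite tower_Derive_n by exact HG.
    (* Write m = jn + r with r < j; the spread bound then carries the weight N_n^j = M_{jn}, at most
       M_m by monotonicity. *)
    assert (Hm := Nat.div_mod_eq m j).
    assert (Hr := Nat.mod_upper_bound m j ltac:(lia)).
    assert (Hbd := Gb (m / j)%nat (m mod j) t ltac:(lia)).
    rewrite <- Hm, root_seq_pow in Hbd by assumption.
    eapply Rle_trans; [exact Hbd|]. apply Rmult_le_compat_l.
    + apply Rmult_le_pos; [lra|apply pow_le; lra].
    + apply normalized_le; auto. lia.
  - intros n. rewrite tower_Derive_n by exact HG. apply G0. lra.
Qed.

(** * Reduction to normalized sequences *)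

Definition normalization (M : nat -> R) (n : nat) : R :=
  M n * (M 0%nat / M 1%nat) ^ n / M 0%nat.

Lemma normalization_pos (M : nat -> R) :
  positive_seq M -> positive_seq (normalization M).
Proof.
  intros hpos n. apply Rdiv_lt_0_compat; [|apply hpos].
  apply Rmult_lt_0_compat; [apply hpos|].
  apply pow_lt, Rdiv_lt_0_compat; apply hpos.
Qed.

Lemma normalization_normalized (M : nat -> R) :
  positive_seq M -> normalized (normalization M).
Proof.
  intros hpos.
  assert (P0 := hpos 0%nat). assert (P1 := hpos 1%nat).
  split; unfold normalization; simpl; field; lra.
Qed.

Lemma normalization_log_convex (M : nat -> R) :
  positive_seq M -> log_convex M -> log_convex (normalization M).
Proof.
  intros hpos hconv [|n] Hn; [lia|]. specialize (hconv (S n) Hn).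
  replace (S n - 1)%nat with n in * by lia.
  replace (S n + 1)%nat with (S (S n)) in * by lia.
  unfold normalization. set (q := M 0%nat / M 1%nat) in *.
  assert (P0 := hpos 0%nat).
  replace ((M (S n) * q ^ S n / M 0%nat) ^ 2)
    with ((q ^ S n / M 0%nat) ^ 2 * M (S n) ^ 2) by (field; lra).
  replace (M n * q ^ n / M 0%nat * (M (S (S n)) * q ^ S (S n) / M 0%nat))
    with ((q ^ S n / M 0%nat) ^ 2 * (M n * M (S (S n)))) by (simpl; field; lra).
  apply Rmult_le_compat_l; [apply pow2_ge_0|exact hconv].
Qed.

Lemma normalization_inv (M : nat -> R) (n : nat) :
  positive_seq M ->
  M n = M 0%nat * (M 1%nat / M 0%nat) ^ n * normalization M n.
Proof.
  intros hpos.
  assert (P0 := hpos 0%nat). assert (P1 := hpos 1%nat).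
  unfold normalization.
  replace (M 0%nat * (M 1%nat / M 0%nat) ^ n *
           (M n * (M 0%nat / M 1%nat) ^ n / M 0%nat))
    with (M n * ((M 1%nat / M 0%nat) ^ n * (M 0%nat / M 1%nat) ^ n))
    by (field; lra).
  rewrite <- Rpow_mult_distr.
  replace (M 1%nat / M 0%nat * (M 0%nat / M 1%nat)) with 1 by (field; lra).
  rewrite pow1. ring.
Qed.

(** The j-th root of c d^(jn) is c^(1/j) d^n: the geometric ratio survives the root unchanged. *)
Lemma root_seq_scale (M N : nat -> R) (c d : R) (j : nat) :
  (1 <= j)%nat -> positive_seq N -> 0 < c -> 0 < d ->
  (forall n, M n = c * d ^ n * N n) ->
  forall n, root_seq j M n = Rpower c (/ INR j) * d ^ n * root_seq j N n.
Proof.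
  intros Hj hN Hc Hd HM n. unfold root_seq.
  rewrite HM, Nat.mul_comm, pow_mult.
  rewrite <- Rpower_mult_distr, <- Rpower_mult_distr, Rpower_root_pow;
    auto using pow_lt, Rmult_lt_0_compat.
Qed.

Lemma quasi_analytic_scale (M N : nat -> R) (c d : R) :
  0 < c -> 0 < d -> (forall n, M n = c * d ^ n * N n) ->
  quasi_analytic M <-> quasi_analytic N.
Proof.
  intros Hc Hd HM. split.
  - apply quasi_analytic_mono with (/ c) (/ d); try now apply Rinv_0_lt_compat.
    intros n. right. rewrite HM, pow_inv. field.
    split; [apply pow_nonzero|]; lra.
  - apply quasi_analytic_mono with c d; auto. intros n. now rewrite HM; right.
Qed.

(** Both sides are invariant under geometric rescaling, so M may be taken normalized. Then one
    direction is the convolution argument and the other the comparison of M_n with its root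
    sequence. *)
Lemma quasi_analytic_root_iff (M : nat -> R) (j : nat) :
  positive_seq M -> log_convex M -> (1 <= j)%nat ->
  quasi_analytic M <-> quasi_analytic (root_seq j M).
Proof.
  intros hpos hconv Hj. set (N := normalization M).
  assert (HN := normalization_pos M hpos).
  assert (HNc := normalization_log_convex M hpos hconv).
  assert (HNn := normalization_normalized M hpos).
  assert (HM := fun n => normalization_inv M n hpos).
  assert (Hd : 0 < M 1%nat / M 0%nat) by (apply Rdiv_lt_0_compat; apply hpos).
  rewrite (quasi_analytic_scale M N _ _ (hpos 0%nat) Hd HM).
  rewrite (quasi_analytic_scale (root_seq j M) (root_seq j N)
    (Rpower (M 0%nat) (/ INR j)) (M 1%nat / M 0%nat) (exp_pos _) Hd
    (root_seq_scale M N _ _ j Hj HN (hpos 0%nat) Hd HM)).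
  split; [now apply quasi_analytic_root_normalized|].
  apply quasi_analytic_mono with 1 1; try apply Rlt_0_1.
  intros n. rewrite pow1, !Rmult_1_l. now apply le_root_seq.
Qed.

Theorem lemma4p3 (M : nat -> R) (hpos : positive_seq M) (hconv : log_convex M) :
  (quasi_analytic M <->
     (exists j : nat, (1 <= j)%nat /\ quasi_analytic (root_seq j M))) /\
  ((exists j : nat, (1 <= j)%nat /\ quasi_analytic (root_seq j M)) <->
     (forall j : nat, (1 <= j)%nat -> quasi_analytic (root_seq j M))).
Proof.
  assert (Hiff := quasi_analytic_root_iff M).
  split; split.
  - intros HM. exists 1%nat. split; [lia|]. apply Hiff; auto.
  - intros [j [Hj HQ]]. now apply (Hiff j).
  - intros [i [Hi HQ]] j Hj. apply Hiff; auto. now apply (Hiff i).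
  - intros HQ. exists 1%nat. split; [lia|]. apply HQ. lia.
Qed.
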